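(* Let $G$ be a $3$-Engel group of exponent $5$. Then $G$ is solvable if and only if $G$ is nilpotent.
   Context: A group is $3$-Engel if $[x,y,y,y]=1$ for all $x,y$, with left-normed commutators ($[x,y,z]=[[x,y],z]$, $[g,h]=g^{-1}h^{-1}gh$). A group has exponent $5$ if $g^5=1$ for every element $g$. $G$ is not assumed finitely generated. *)

(* Defs.v *)
From mathcomp Require Import all_boot.
From mathcomp Require Import classical_sets.

Set Implicit Arguments.
Unset Strict Implicit.
Unset Printing Implicit Defensive.

Local Open Scope classical_set_scope.
Local Open Scope group_scope.

(* MathComp's solvable and nilpotent concern only subgroups of a finGroupType;
   the notions below are for an arbitrary, possibly infinite, groupType. *)

(* [~ x1, ..., xn] is left-normed and [~ x, y] = x^-1 * (y^-1 * (x * y)). *)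
Definition Engel3 (G : groupType) : Prop :=
  forall x y : G, [~ x, y, y, y] = 1.

(* This allows the trivial group. *)
Definition exponent5 (G : groupType) : Prop :=
  forall g : G, g ^+ 5 = 1.

Definition is_subgroup (G : groupType) (H : set G) : Prop :=
  [/\ H 1,
      forall x y, H x -> H y -> H (x * y)
    & forall x, H x -> H x^-1].

Definition generated (G : groupType) (A : set G) : set G :=
  smallest (@is_subgroup G) A.

Definition commutator_subgroup (G : groupType) (A B : set G) : set G :=
  generated [set [~ x, y] | x in A & y in B].

Fixpoint derived_series (G : groupType) (n : nat) : set G :=
  if n is m.+1
  then commutator_subgroup (derived_series m) (derived_series m)
  else [set: G].
Arguments derived_series : clear implicits.

(* Indexed from 0: lower_central_series G n is the usual gamma_(n+1)(G). *)
Fixpoint lower_central_series (G : groupType) (n : nat) : set G :=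
  if n is m.+1
  then commutator_subgroup (lower_central_series m) [set: G]
  else [set: G].
Arguments lower_central_series : clear implicits.

Definition solvable_group (G : groupType) : Prop :=
  exists n : nat, derived_series G n = [set 1].

Definition nilpotent_group (G : groupType) : Prop :=
  exists n : nat, lower_central_series G n = [set 1].

(* Main.v *)
(* If G has derived length d, argue by induction downwards along the derived
   series: let H be a term of it, N = [H, H], and suppose that N is nilpotent.
   The abelian group V = N / [N, N] is annihilated by 5, and the operators
   X = x - 1 on V, for x in H, commute and satisfy X^3 = 0.  For x and y in H,
   X - Y is an invertible operator times z - 1 with z = y^-1 * x, hence
   (X - Y)^3 = 0, which gives X^2 Y = X Y^2.  Replacing y by y^-1 yields
   X^2 (2 Y + Y^2) = 0, hence X^2 Y = 0 as 2 is invertible.  Then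
   (X - Y)^2 Z = 0 linearizes to X Y Z = 0.  Thus H acts nilpotently on
   N / [N, N], and a theorem of P. Hall shows that H is nilpotent. *)

Require Import Defs.
From HB Require Import structures.
From mathcomp Require Import all_boot.
From mathcomp Require Import ssralg.
From mathcomp Require Import boolp classical_sets.

Set Implicit Arguments.
Unset Strict Implicit.
Unset Printing Implicit Defensive.

Import GRing.Theory.
Local Open Scope classical_set_scope.
Local Open Scope group_scope.

(** * Normal subgroups and commutator subgroups *)

Section Subgroups.
Variable G : groupType.
Implicit Types (A B H K N : set G) (x y z : G).

Lemma Hall_Witt x y z :
  [~ x, y^-1, z] ^ y * [~ y, z^-1, x] ^ z * [~ z, x^-1, y] ^ x = 1.
Proof. by rewrite /commg /conjg !gnorm. Qed.

Lemma commMg x y z : [~ x * y, z] = [~ x, z] ^ y * [~ y, z].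
Proof. by rewrite /commg /conjg !gnorm. Qed.

Lemma commVg x y : [~ x^-1, y] = [~ x, y]^-1 ^ x^-1.
Proof. by rewrite /commg /conjg !gnorm. Qed.

Definition normal_in H K :=
  [/\ is_subgroup K, K `<=` H & forall h x, H h -> K x -> K (x ^ h)].

Lemma normal_in_refl H : is_subgroup H -> normal_in H H.
Proof.
move=> sH; have [H1 HM HV] := sH; split=> // h x Hh Hx.
by apply: (HM) (HV _ Hh) _; apply: HM.
Qed.

Lemma normal_in1 H : is_subgroup H -> normal_in H [set 1].
Proof.
move=> [H1 HM HV]; split=> [|x ->//|h x _ ->]; last by rewrite /= conj1g.
by split=> [//|x y -> ->|x ->]; rewrite /= ?mulg1 ?invg1.
Qed.

Lemma normal_in_comm H K x h : normal_in H K -> K x -> H h -> K [~ x, h].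
Proof. by move=> [[_ KM KV] _ KJ] Kx Hh; apply: KM (KV _ Kx) (KJ _ _ Hh Kx). Qed.

Lemma normal_in_cap H A B :
  normal_in H A -> normal_in H B -> normal_in H (A `&` B).
Proof.
move=> [[A1 AM AV] sAH AJ] [[B1 BM BV] _ BJ]; split=> [|x [/sAH//]|h x Hh [Ax Bx]].
  by split=> [//|x y [Ax Bx] [Ay By]|x [Ax Bx]]; split;
    [apply: AM | apply: BM | apply: AV | apply: BV].
by split; [apply: AJ | apply: BJ].
Qed.

Lemma generated_subgroup A : is_subgroup (generated A).
Proof.
split=> [B [[]//]|x y Ax Ay B sAB|x Ax B sAB].
  by have [[_ BM _] _] := sAB; apply: BM; [apply: Ax | apply: Ay].
by have [[_ _ BV] _] := sAB; apply: BV; apply: Ax.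
Qed.

Lemma commutator_subgroup_mem A B a b :
  A a -> B b -> commutator_subgroup A B [~ a, b].
Proof. by move=> Aa Bb; apply: sub_gen_smallest; exists a => //; exists b. Qed.

Lemma commutator_subgroup_sub A B K :
  is_subgroup K -> (forall a b, A a -> B b -> K [~ a, b]) ->
  commutator_subgroup A B `<=` K.
Proof. by move=> sK ABK; apply: smallest_sub => // _ [a Aa [b Bb <-]]; apply: ABK. Qed.

Lemma commutator_subgroup_normal H A B :
    is_subgroup H -> normal_in H A -> normal_in H B ->
  normal_in H (commutator_subgroup A B).
Proof.
move=> sH nA nB; have [H1 HM HV] := sH.
have [[_ AM AV] sAH AJ] := nA; have [_ sBH BJ] := nB.
split=> [||h x Hh]; first exact: generated_subgroup.
  apply: commutator_subgroup_sub => // a b /sAH Ha /sBH Hb.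
  exact: normal_in_comm (normal_in_refl sH) _ _.
have [C1 CM CV] := generated_subgroup [set [~ x, y] | x in A & y in B].
suff: commutator_subgroup A B `<=` [set y | commutator_subgroup A B (y ^ h)].
  exact.
apply: commutator_subgroup_sub.
  split=> [|y z Cy Cz|y Cy] /=; first by rewrite conj1g.
    by rewrite conjMg; apply: CM.
  by rewrite conjVg; apply: CV.
move=> a b Aa Bb /=; rewrite conjRg.
by apply: commutator_subgroup_mem; [apply: AJ | apply: BJ].
Qed.

(** * Centralizers modulo [K], the three subgroups lemma, upper central series *)

Definition centralizer_mod H A K : set G :=
  [set x | H x /\ forall a, A a -> K [~ x, a]].

Lemma centralizer_mod_normal H A K :
    is_subgroup H -> normal_in H A -> normal_in H K ->
  normal_in H (centralizer_mod H A K).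
Proof.
move=> sH [_ _ AJ] [[K1 KM KV] _ KJ]; have [H1 HM HV] := sH.
split=> [|x []//|h x Hh [Hx xA]].
  split=> [|x y [Hx xA] [Hy yA]|x [Hx xA]].
  - by split=> // a Aa; rewrite comm1g.
  - split=> [|a Aa]; first exact: HM.
    by rewrite commMg; apply: KM; [apply: KJ => //; apply: xA | apply: yA].
  - split=> [|a Aa]; first exact: HV.
    by rewrite commVg; apply: KJ; [apply: HV | apply: KV; apply: xA].
split=> [|a Aa]; first by have [_ _] := normal_in_refl sH; apply.
rewrite -(conjgKV h a) -conjRg; apply: KJ => //; apply: xA.
by apply: AJ => //; apply: HV.
Qed.

(** The Hall-Witt identity at [a], [b^-1], [c] expresses a conjugate of [[~ a, b, c]] through
    conjugates of the two other commutators. Working with elements keeps the hypotheses free of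
    generated subgroups. *)
Lemma three_subgroups H A B C K :
    normal_in H A -> normal_in H B -> normal_in H C -> normal_in H K ->
    (forall a c b, A a -> C c -> B b -> K [~ a, c, b]) ->
    (forall b c a, B b -> C c -> A a -> K [~ b, c, a]) ->
  forall a b c, A a -> B b -> C c -> K [~ a, b, c].
Proof.
move=> nA [[_ _ BV] sBH _] [[_ _ CV] sCH _] [[_ KM KV] _ KJ].
have [[_ _ AV] sAH _] := nA; move=> ACB BCA a b c Aa Bb Cc.
have HW := Hall_Witt a b^-1 c; rewrite invgK in HW.
have K2 : K [~ b^-1, c^-1, a] by apply: BCA => //; [apply: BV | apply: CV].
(* As [[~ c, a^-1]] inverts [[~ a^-1, c]], this is a conjugate of an inverse of a commutator covered
   by [ACB]. *)
have K3 : K [~ c, a^-1, b^-1].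
  rewrite -(invgR a^-1 c) commVg; apply: KJ.
    apply/sAH/AV/(normal_in_comm nA); [exact: AV | exact: sCH].
  by apply: KV; apply: ACB => //; [apply: AV | apply: BV].
suff: K ([~ a, b, c] ^ b^-1).
  by move=> /(KJ b _ (sBH _ Bb)); rewrite conjgKV.
move/(canRL (mulgK _)): HW => /(canRL (mulgK _)) ->.
by rewrite mul1g -invgM; apply: KV; apply: KM; apply: KJ => //;
   [apply: sCH | apply: sAH].
Qed.

(* [zeta H K s] is the preimage in [H] of the [s]-th term of the upper central
   series of [H / K]. *)
Fixpoint zeta H K s : set G :=
  if s is s'.+1 then centralizer_mod H H (zeta H K s') else K.

Lemma zeta_normal H K s :
  is_subgroup H -> normal_in H K -> normal_in H (zeta H K s).
Proof.
move=> sH nK; elim: s => [//|s IHs] /=.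
exact: centralizer_mod_normal (normal_in_refl sH) IHs.
Qed.

Lemma sub_zeta H K s :
  is_subgroup H -> normal_in H K -> K `<=` zeta H K s.
Proof.
move=> sH nK; elim: s => [//|s IHs] x Kx /=.
have [_ sKH _] := nK; split=> [|h Hh]; first exact: sKH.
exact: IHs (normal_in_comm nK Kx Hh).
Qed.

Lemma zeta_mono H K L s : K `<=` L -> zeta H K s `<=` zeta H L s.
Proof.
move=> sKL; elim: s => [//|s IHs] x /= [Hx Kx].
by split=> // h Hh; apply: IHs; apply: Kx.
Qed.

Lemma zeta_add H K s t : zeta H (zeta H K t) s = zeta H K (s + t).
Proof. by elim: s => [//|s IHs] /=; rewrite IHs. Qed.

(** The commutator behaves like a bilinear map from [A / A'] and [B / B'] to [H / K]. By the three
    subgroups lemma, commuting with [h] in [H] moves [h] onto one argument, which lowers [s] or [t]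
    by one. *)
Lemma zeta_comm H A A' B B' K s t :
    is_subgroup H -> normal_in H A -> normal_in H A' -> normal_in H B ->
    normal_in H B' -> normal_in H K ->
    (forall a b, A' a -> B b -> K [~ a, b]) ->
    (forall a b, A a -> B' b -> K [~ a, b]) ->
  forall a b, A a -> zeta H A' s a -> B b -> zeta H B' t b ->
  zeta H K (s + t) [~ a, b].
Proof.
move=> sH nA nA' nB nB' nK A'B AB'.
elim: s t => [|s IHs] t; first by move=> a b _ A'a Bb _; apply: sub_zeta => //; apply: A'B.
elim: t => [|t IHt] a b Aa sa Bb tb; first by apply: sub_zeta => //; apply: AB'.
have [sAH sBH] : A `<=` H /\ B `<=` H by have [] := nA; have [] := nB.
rewrite addSn /=; split.
  by apply: normal_in_comm (normal_in_refl sH) _ _; [apply: sAH | apply: sBH].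
move=> h Hh; have nZ := zeta_normal (s + t.+1) sH nK.
have [[_ _ ZV] _ _] := nZ.
apply: (three_subgroups (A := A `&` zeta H A' s.+1) (B := B `&` zeta H B' t.+1)
  _ _ (normal_in_refl sH)) nZ _ _ _ _ _ _ _ _ => //.
- exact: normal_in_cap nA (zeta_normal s.+1 sH nA').
- exact: normal_in_cap nB (zeta_normal t.+1 sH nB').
- move=> {}a g {}b [{}Aa [_ {}sa]] Hg [{}Bb {}tb].
  by apply: IHs => //; [apply: normal_in_comm nA _ _ | apply: sa].
- move=> {}b g {}a [{}Bb [_ {}tb]] Hg [{}Aa {}sa].
  rewrite -invgR; apply: ZV; rewrite addnS -addSn.
  by apply: IHt => //; [apply: normal_in_comm nB _ _ | apply: tb].
Qed.

(** * Lower central series and Hall's criterion *)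

Fixpoint lower_central H i : set G :=
  if i is j.+1 then commutator_subgroup (lower_central H j) H else H.

Lemma lower_central_normal H N i :
  is_subgroup H -> normal_in H N -> normal_in H (lower_central N i).
Proof.
by move=> sH nN; elim: i => [//|i IHi] /=; apply: commutator_subgroup_normal.
Qed.

(** By the three subgroups lemma, a commutator with [[~ x, y]] reduces to commuting with [x] and [y]
    in turn, which goes down two terms. [Hall_nilpotency] needs this as a hypothesis of
    [zeta_comm]. *)
Lemma lower_central_comm2 N i : is_subgroup N ->
  forall a b, lower_central N i a -> lower_central N 1 b ->
  lower_central N i.+2 [~ a, b].
Proof.
move=> sN; have nN j := lower_central_normal j sN (normal_in_refl sN).
have [_ _ LV] : is_subgroup (lower_central N i.+2) by have [] := nN i.+2.
have nC := centralizer_mod_normal sN (nN i) (nN i.+2).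
move=> a b La Lb; rewrite -invgR; apply: LV.
suff: commutator_subgroup N N `<=`
      centralizer_mod N (lower_central N i) (lower_central N i.+2).
  by case/(_ b Lb) => _; apply.
apply: commutator_subgroup_sub; first by have [] := nC.
move=> x y Nx Ny; split; first exact: normal_in_comm (normal_in_refl sN) _ _.
move=> c Lc.
have LNN d u v : lower_central N i d -> N u -> N v ->
    lower_central N i.+2 [~ u, d, v].
  move=> Ld Nu Nv; apply: commutator_subgroup_mem => //; rewrite -invgR.
  have [[_ _ LV1] _ _] := nN i.+1.
  by apply: LV1; apply: commutator_subgroup_mem.
have nNN := normal_in_refl sN.
by apply: (three_subgroups nNN nNN (nN i) (nN i.+2)) Nx Ny Lc => u d v Nu Ld Nv;
  apply: LNN.
Qed.

(* P. Hall's criterion: passing from [lower_central N i] to the next term, the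
   numbers of steps that [H] needs add up, by [zeta_comm]. *)
Lemma Hall_nilpotency H N k c :
    is_subgroup H -> normal_in H N -> N `<=` zeta H (lower_central N 1) k ->
  lower_central N c = [set 1] -> exists m, N `<=` zeta H [set 1] m.
Proof.
move=> sH nN Nk Nc; have [sN _ _] := nN.
have nL i := lower_central_normal i sH nN.
have step i : exists m, lower_central N i `<=` zeta H (lower_central N i.+1) m.
  elim: i => [|i [m IHm]]; first by exists k.
  exists (m + k) => /=; apply: commutator_subgroup_sub.
    by have [] := zeta_normal (m + k) sH (nL i.+2).
  move=> a b La Nb.
  apply: (zeta_comm sH (nL i) (nL i.+1) nN (nL 1%N) (nL i.+2) _ _ La _ Nb).
  - by move=> u v; apply: commutator_subgroup_mem.
  - by move=> u v; apply: lower_central_comm2.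
  - exact: IHm.
  - exact: Nk.
have reach i : exists m, N `<=` zeta H (lower_central N i) m.
  elim: i => [|i [m IHm]]; first by exists 0.
  have [m' Lm'] := step i; exists (m + m') => x /IHm.
  by rewrite -zeta_add; apply: zeta_mono.
by have [m] := reach c; rewrite Nc; exists m.
Qed.

(** Each commutation with [H] lowers the [zeta] index by one, so after [m] more terms it reaches
    [zeta H [set 1] 0], which is trivial. *)
Lemma lower_central_zeta H m : is_subgroup H ->
  lower_central H 1 `<=` zeta H [set 1] m -> lower_central H m.+1 = [set 1].
Proof.
move=> sH H1; have n1 := normal_in1 sH.
have L i : i <= m -> lower_central H i.+1 `<=` zeta H [set 1] (m - i).
  elim: i => [|i IHi] lim; first by rewrite subn0.
  rewrite [lower_central H _]/=; apply: commutator_subgroup_sub.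
    by have [] := zeta_normal (m - i.+1) sH n1.
  move=> a b La Hb; have := IHi (ltnW lim) _ La.
  by rewrite subnS -(prednK (n := m - i)) ?subn_gt0 //=; case=> _; apply.
apply/seteqP; split=> [x /(L m (leqnn m))|x ->]; first by rewrite subnn.
by have [[]] := lower_central_normal m.+1 sH (normal_in_refl sH).
Qed.

End Subgroups.

(** * An abelian section as a [zmodType] *)

Section AbelianSection.
Variables (G : groupType) (N K : set G).
Hypotheses (sN : is_subgroup N) (sK : is_subgroup K).
Hypothesis abNK : forall x y, N x -> N y -> K [~ x, y].

(** The choice depends only on the set, so elements of one coset share their representative. For [x]
    in [N] the default 1 is not reached, since [x] itself qualifies. *)
Definition coset_rep (x : G) : G := xget 1 [set y | N y /\ K (x^-1 * y)].

Lemma coset_repP x : N x -> N (coset_rep x) /\ K (x^-1 * coset_rep x).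
Proof.
move=> Nx; apply: (xgetPex 1 (P := [set y | N y /\ K (x^-1 * y)])).
exists x; split=> //=.
by rewrite mulVg; case: sK.
Qed.

Lemma coset_rep_eq x y : N x -> N y -> (coset_rep x = coset_rep y <-> K (x^-1 * y)).
Proof.
move=> Nx Ny; have [K1 KM KV] := sK.
have [_ Kx] := coset_repP Nx; have [_ Ky] := coset_repP Ny.
split=> [exy|Kxy].
  by rewrite exy in Kx; have := KM _ _ Kx (KV _ Ky); rewrite !gnorm.
congr (xget _ _); apply/predeqP => z /=; split=> -[Nz Kz]; split=> //.
  by have := KM _ _ (KV _ Kxy) Kz; rewrite !gnorm.
by have := KM _ _ Kxy Kz; rewrite !gnorm.
Qed.

Lemma abelian_section : exists (V : zmodType) (f : G -> V) (r : V -> G),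
  [/\ forall v, N (r v), cancel r f,
      forall x y, N x -> N y -> f (x * y) = (f x + f y)%R
    & forall x, N x -> f x = 0%R <-> K x].
Proof.
have [N1 NM NV] := sN; have [K1 KM KV] := sK.
pose P x := `[< N x /\ coset_rep x = x >].
pose T : choiceType := {x : G | P x}.
have repP x : N x -> P (coset_rep x).
  move=> Nx; have [Nr Kr] := coset_repP Nx; apply/asboolP; split=> //.
  by symmetry; apply/coset_rep_eq.
have rN (v : T) : N (val v) by case: v => x /= /asboolP[].
have rE (v : T) : coset_rep (val v) = val v by case: v => x /= /asboolP[].
pose t1 : T := Sub (coset_rep 1) (repP _ N1).
(* The default [t1] can occur only for [x] outside [N]. *)
pose f x : T := insubd t1 (coset_rep x).
have fE x : N x -> val (f x) = coset_rep x.
  by move=> Nx; rewrite /f val_insubd repP.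
have rK : cancel val f by move=> v; apply: val_inj; rewrite fE.
have fP x y : N x -> N y -> f x = f y <-> K (x^-1 * y).
  move=> Nx Ny; rewrite -coset_rep_eq // -!fE //.
  by split=> [->|/val_inj].
have fl x y : N x -> N y -> f (val (f x) * y) = f (x * y).
  move=> Nx Ny; have [Nr Kr] := coset_repP Nx.
  symmetry; apply/fP; rewrite ?fE //; do ?exact: NM.
  (* The left side is the conjugate by [y] of an element [k] of both [N] and [K]; in the form [k *
     [~ k, y]] it lies in [K] by [abNK]. *)
  have -> : (x * y)^-1 * (coset_rep x * y)
    = (x^-1 * coset_rep x) * [~ x^-1 * coset_rep x, y].
    by rewrite /commg /conjg !gnorm.
  by apply: KM => //; apply: abNK => //; apply: NM => //; apply: NV.
have fC x y : N x -> N y -> f (x * y) = f (y * x).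
  move=> Nx Ny; apply/fP; do ?exact: NM.
  have -> : (x * y)^-1 * (y * x) = [~ y, x] by rewrite /commg /conjg !gnorm.
  exact: abNK.
have fr x y : N x -> N y -> f (x * val (f y)) = f (x * y).
  by move=> Nx Ny; rewrite fC // fl // fC.
pose add (v w : T) := f (val v * val w).
pose opp (v : T) := f (val v)^-1.
have addA : associative add.
  by move=> u v w; rewrite /add fr ?fl ?mulgA //; apply: NM.
have addC : commutative add by move=> u v; apply: fC.
have add0 : left_id (f 1) add.
  by move=> u; rewrite /add fl // mul1g rK.
have addN : left_inverse (f 1) opp add.
  by move=> u; rewrite /add /opp fl ?mulVg //; apply: NV.
pose V : zmodType := HB.pack T (GRing.isZmodule.Build T addA addC add0 addN).
exists V, f, val; split=> // [x y Nx Ny|x Nx].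
  by rewrite -[RHS]/(add (f x) (f y)) /add fl ?fr.
rewrite -[0%R]/(f 1); split=> [fx1|Kx].
  by have /KV := (fP x 1 Nx N1).1 fx1; rewrite mulg1 invgK.
by apply/fP => //; rewrite mulg1; apply: KV.
Qed.
End AbelianSection.

(** * Products of three commuting operators with zero cubes *)

(* [u x] stands for the operator [x - 1], and [g x] for [x] itself. *)
Section CommutingOperators.
Variables (G : groupType) (H : set G) (V : zmodType) (u : G -> V -> V).
Local Open Scope ring_scope.
Hypothesis HV : forall x, H x -> H x^-1%g.
Hypothesis HM : forall x y, H x -> H y -> H (x * y)%g.
Hypothesis uB : forall x v w, H x -> u x (v - w) = u x v - u x w.
Hypothesis u1 : forall v, u 1%g v = 0.
Hypothesis uM : forall x y v, H x -> H y ->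
  u (x * y)%g v = u x v + u y v + u x (u y v).
Hypothesis uC : forall x y v, H x -> H y -> u x (u y v) = u y (u x v).
Hypothesis u3 : forall x v, H x -> u x (u x (u x v)) = 0.
Hypothesis V2 : forall v : V, v *+ 2 = 0 -> v = 0.
Hypothesis V3 : forall v : V, v *+ 3 = 0 -> v = 0.

Let u0 x : H x -> u x 0 = 0.
Proof. by move=> Hx; rewrite -[in LHS](subrr 0) uB // subrr. Qed.

Let uN x v : H x -> u x (- v) = - u x v.
Proof. by move=> Hx; rewrite -[in LHS]sub0r uB // u0 // sub0r. Qed.

Let uD x v w : H x -> u x (v + w) = u x v + u x w.
Proof. by move=> Hx; rewrite -{1}[w]opprK uB // uN // opprK. Qed.

Let g x v := v + u x v.

Let gC x y v : H x -> H y -> g y (u x v) = u x (g y v).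
Proof. by move=> Hx Hy; rewrite /g uD // uC. Qed.

Let g0 x : H x -> g x 0 = 0.
Proof. by move=> Hx; rewrite /g u0 // addr0. Qed.

Let u_sub x y v : H x -> H y ->
  u x v - u y v = g y (u (y^-1 * x)%g v).
Proof.
move=> Hx Hy; have Hyx : H (y^-1 * x)%g by apply: HM => //; apply: HV.
rewrite -{1}(mulVKg y x) uM // /g.
by rewrite addrC -!addrA addKr.
Qed.

Let uuD x y v (D := fun v => u x v - u y v) : H x -> H y -> D (D (D v)) = 0.
Proof.
move=> Hx Hy; have Hyx : H (y^-1 * x)%g by apply: HM => //; apply: HV.
rewrite /D !u_sub //.
by rewrite -!gC // u3 // !g0.
Qed.

(** In the expansion of [(X - Y)^3 = 0] the pure cubes vanish, which leaves
    [3 (X Y^2 - X^2 Y) = 0]. *)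
Let swap x y v : H x -> H y -> u x (u x (u y v)) = u x (u y (u y v)).
Proof.
move=> Hx Hy; have := uuD v Hx Hy => /=.
rewrite !uB // !u3 // ?u0 //.
rewrite !(uC (x := y) (y := x)) //.
set p := u x (u x (u y v)); set q := u x (u y (u y v)).
rewrite subr0 sub0r !opprB addrACA [- p + q]addrC => h.
apply/esym/eqP; rewrite -subr_eq0; apply/eqP/V3.
by rewrite mulrS mulr2n.
Qed.

Let uV y v : H y -> g y (u y^-1%g v) = - u y v.
Proof.
move=> Hy; apply/eqP; rewrite -addr_eq0 addrC addrA -uM ?mulgV ?u1 //.
exact: HV.
Qed.

Let sq0 x y v : H x -> H y -> u x (u x (u y v)) = 0.
Proof.
move=> Hx Hy; have HyV := HV Hy.
have twice w : u x (u x (u y w)) *+ 2 = - u x (u x (u y (u y w))).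
  have uV2 : g y (g y (u y^-1%g (u y^-1%g w))) = u y (u y w).
    by rewrite [g y (u _ (u _ _))]gC // uV // uV // uN // opprK.
  (* Applying [y] twice to [swap] for [y^-1] clears the inverses: it becomes
     [- X^2 (1 + Y) Y = X Y^2], whose right side is [X^2 Y]. *)
  move: (congr1 (fun t => g y (g y t)) (swap w Hx HyV)).
  set S := u x (u x (u y w)); set T := u x (u x (u y (u y w))).
  rewrite !(gC (x := x)) // uV2 uV // -(swap _ Hx Hy) /g.
  rewrite uN // !uD // !uN // -/S -/T => h.
  by rewrite mulr2n -{2}h addrA subrr sub0r.
(* [twice] at [Y v] has [Y^3] on the right, so it gives [X^2 Y^2 = 0]; then [twice] at [v] gives
   [X^2 Y = 0]. *)
have yy0 : u x (u x (u y (u y v))) = 0.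
  by apply: V2; rewrite twice u3 // !u0 // oppr0.
by apply: V2; rewrite twice yy0 oppr0.
Qed.

Lemma triple_product_zero x y z v : H x -> H y -> H z -> u x (u y (u z v)) = 0.
Proof.
move=> Hx Hy Hz.
have Hyx : H (y^-1 * x)%g by apply: HM => //; apply: HV.
pose D t := u x t - u y t.
(* [X - Y] is [g y] composed with [u (y^-1 * x)], so [sq0] applies; expanding then leaves only
   [- 2 X Y Z]. *)
have : D (D (u z v)) = 0.
  by rewrite /D !u_sub // -!gC // sq0 // !g0.
rewrite /D !uB // !sq0 // (uC (u z v) Hy Hx) sub0r subr0 => h.
by apply: V2; rewrite mulr2n -[LHS]opprK opprD h oppr0.
Qed.
End CommutingOperators.

(** * The action of [H] on [N / K] *)

(** Modulo [K], the map from [a] to [[~ a, x]] is the operator [x - 1] on [N / K], so the claim is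
    that triple products of such operators vanish. *)
Lemma Engel3_acts_nilpotently (G : groupType) (H N K : set G) :
    Engel3 G -> exponent5 G -> is_subgroup H ->
    normal_in H N -> normal_in H K ->
    (forall x y, H x -> H y -> N [~ x, y]) ->
    (forall x y, N x -> N y -> K [~ x, y]) ->
  N `<=` zeta H K 3.
Proof.
move=> hE h5 sH nN nK HHN NNK.
have [H1 HM HV] := sH; have [sN sNH NJ] := nN; have [sK _ KJ] := nK.
have [N1 NM NV] := sN; have [K1 _ _] := sK.
have [V [f [r [rN rK fM fK]]]] := abelian_section sN sK NNK.
have NR a x : N a -> H x -> N [~ a, x] by move=> Na Hx; apply: NM; auto.
have f1 : f 1 = 0%R by apply/fK.
have fV a : N a -> f a^-1 = (- f a)%R.
  by move=> Na; apply/eqP; rewrite -addr_eq0 -fM ?mulVg ?f1 //; apply: NV.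
have fR a x : N a -> H x -> f [~ a, x] = (f (a ^ x) - f a)%R.
  by move=> Na Hx; rewrite fM ?fV ?(addrC (- _)%R) //; [apply: NV | apply: NJ].
have fJ a b x : N a -> N b -> H x -> f a = f b -> f (a ^ x) = f (b ^ x).
  move=> Na Nb Hx eab; apply/eqP; rewrite -subr_eq0 -fV; last exact: NJ.
  rewrite -conjVg -fM -?conjMg; do ?[exact: NJ | apply: NJ => //; exact: NV].
  apply/eqP/fK; first by apply: NJ => //; apply: NM => //; apply: NV.
  apply: KJ => //; apply/fK; first by apply: NM => //; apply: NV.
  by rewrite fM ?fV ?eab ?subrr //; apply: NV.
have fJN a n : N a -> N n -> f (a ^ n) = f a.
  move=> Na Nn; apply/eqP; rewrite -subr_eq0 -fR //; last exact: sNH.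
  by apply/eqP/fK; [apply: NR => //; apply: sNH | apply: NNK].
pose u x v := f [~ r v, x].
have uE x a : N a -> H x -> u x (f a) = f [~ a, x].
  by move=> Na Hx; rewrite /u !fR // rK (fJ _ a) // rK.
(* The products [x * y] and [y * x] differ by [[~ x, y]], which is in [N] and hence acts
   trivially. *)
have fC a x y : N a -> H x -> H y -> f (a ^ (x * y)) = f (a ^ (y * x)).
  move=> Na Hx Hy; rewrite (commgC x y) conjgM fJN //; last exact: HHN.
  by apply: NJ => //; apply: HM.
have fRR a x y : N a -> H x -> H y ->
    f [~ a, y, x] = (f (a ^ (x * y)) - f (a ^ x) - (f (a ^ y) - f a))%R.
  move=> Na Hx Hy; have [Nx Ny] := (NJ _ _ Hx Na, NJ _ _ Hy Na).
  rewrite !fR //; last exact: NR.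
  congr (_ - _)%R; rewrite commgEl conjMg conjVg fM ?fV //.
  - by rewrite addrC fC // conjgM.
  - exact: NV.
  - exact: NJ.
have fX n a : N a -> N (a ^+ n) /\ f (a ^+ n) = (f a *+ n)%R.
  move=> Na; elim: n => [|n [Nn IHn]]; first by rewrite expg0 f1.
  by rewrite expgS fM // IHn mulrS; split=> //; apply: NM.
have V5 (v : V) : (v *+ 5 = 0)%R by rewrite -[v]rK -(fX 5 _ (rN v)).2 h5.
suff u0 x y z v : H x -> H y -> H z -> u z (u y (u x v)) = 0%R.
  move=> a Na; split=> [|x Hx]; first exact: sNH.
  have Nax := NR _ _ Na Hx; split=> [|y Hy]; first exact: sNH.
  have Naxy := NR _ _ Nax Hy; split=> [|z Hz]; first exact: sNH.
  by apply/(fK _ (NR _ _ Naxy Hz)); rewrite -!uE // u0.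
move=> Hx Hy Hz; apply: (triple_product_zero (H := H)) => //.
- move=> {}x {}v w {}Hx.
  have NrV := NV _ (rN w); have Nvw := NM _ _ (rN v) NrV.
  have -> : (v - w)%R = f (r v * (r w)^-1) by rewrite fM // fV // !rK.
  have Nv := NJ _ _ Hx (rN v); have Nw := NJ _ _ Hx (rN w).
  rewrite uE // /u !fR //.
  have -> : f ((r v * (r w)^-1) ^ x) = (f (r v ^ x) - f (r w ^ x))%R.
    by rewrite conjMg conjVg fM ?fV //; apply: NV.
  have -> : f (r v * (r w)^-1) = (f (r v) - f (r w))%R by rewrite fM ?fV.
  by rewrite !opprD !opprK addrACA.
- by move=> {}v; rewrite /u commg1.
- move=> {}x {}y {}v {}Hx {}Hy.
  have Hxy := HM _ _ Hx Hy; have Nry := NR _ _ (rN v) Hy.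
  rewrite -[v]rK !uE // fRR // !fR //.
  by rewrite addrACA subrr addr0 addrC addrA subrK.
- move=> {}x {}y {}v {}Hx {}Hy; rewrite -[v]rK.
  have [Nrx Nry] := (NR _ _ (rN v) Hx, NR _ _ (rN v) Hy).
  rewrite !uE // !fRR // (fC _ _ _ (rN v) Hx Hy) !opprB.
  by rewrite addrACA [RHS]addrACA [in RHS](addrC (- _)%R).
- move=> {}x {}v {}Hx; rewrite -[v]rK.
  have Nr1 := NR _ _ (rN v) Hx; have Nr2 := NR _ _ Nr1 Hx.
  by rewrite !uE // hE f1.
(* Since 5 annihilates [V], invertibility of 2 and 3 comes from [5 = 1 + 2 * 2] and
   [3 * 2 = 1 + 5]. *)
- by move=> {}v v2; have := V5 v; rewrite mulrS (mulrnA v 2 2) v2 mul0rn addr0.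
- by move=> {}v v3; have := mul0rn V 2; rewrite -v3 -mulrnA mulrS V5 addr0.
Qed.

(** * Climbing the derived series *)

Section Nilpotency.
Variable G : groupType.
Implicit Type H : set G.

Lemma nilpotent_from_derived H :
    Engel3 G -> exponent5 G -> is_subgroup H ->
    (exists c, lower_central (commutator_subgroup H H) c = [set 1]) ->
  exists c, lower_central H c = [set 1].
Proof.
move=> hE h5 sH [c Nc]; pose N := lower_central H 1.
have nN : normal_in H N := lower_central_normal 1 sH (normal_in_refl sH).
have N3 : N `<=` zeta H (lower_central N 1) 3.
  apply: Engel3_acts_nilpotently nN (lower_central_normal 1 sH nN) _ _ => //.
    by move=> x y; apply: commutator_subgroup_mem.
  by move=> x y; apply: commutator_subgroup_mem.
have [m Nm] := Hall_nilpotency sH nN N3 Nc.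
by exists m.+1; apply: lower_central_zeta.
Qed.

Lemma derived_series_subgroup i : is_subgroup (derived_series G i).
Proof. by case: i => [//|i]; apply: generated_subgroup. Qed.

Lemma lower_central_seriesE i :
  lower_central_series G i = lower_central [set: G] i.
Proof. by elim: i => [//|i /= ->]. Qed.

Lemma derived_sub_lower_central i :
  derived_series G i `<=` lower_central_series G i.
Proof.
elim: i => [//|i IHi]; apply: commutator_subgroup_sub.
  exact: generated_subgroup.
by move=> a b /IHi La _; apply: commutator_subgroup_mem.
Qed.

End Nilpotency.

Theorem corollary3p9 (G : groupType) (hEngel : Engel3 G) (hexp : exponent5 G) :
  solvable_group G <-> nilpotent_group G.
Proof.
split=> -[n Gn]; last first.
  exists n; apply/seteqP; split=> [x /derived_sub_lower_central|x ->].
    by rewrite Gn.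
  by have [] := derived_series_subgroup G n.
(* The last derived term is trivial, so [c = 0] starts the ascent; it ends at term 0, which is all
   of [G]. *)
have: exists c, lower_central (derived_series G n) c = [set 1] by exists 0.
elim: n {Gn} => [[c Gc]|n IHn /(nilpotent_from_derived hEngel hexp) Gn].
  by exists c; rewrite lower_central_seriesE.
exact/IHn/Gn/derived_series_subgroup.
Qed.
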